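(* Let $\mathscr T=(V,E)$ be a rooted directed tree. Let $S_{\boldsymbol\lambda}\in\boldsymbol B(\ell^2(V))$ be a centered weighted shift on $\mathscr T$ with nonzero weights $\boldsymbol\lambda=\{\lambda_v\}_{v\in V^\circ}$. If $\mathscr T$ has at least one leaf, then the tree $\mathscr T$ has finite depth and $S_{\boldsymbol\lambda}$ is type III centered.
   Context: A directed tree $\mathscr T=(V,E)$ is a directed graph that is connected (as an undirected graph), has no directed circuits, and in which every vertex has at most one parent. $\mathsf{Chi}(u)=\{v\in V:(u,v)\in E\}$ is the set of children of $u$; $\mathsf{par}(u)$ is the parent of $u$ (the unique $v$ with $(v,u)\in E$), if it exists. A vertex without a parent is a root; it is unique if it exists and is denoted $\mathsf{root}$; the tree is rooted if it has a root, and then $V^\circ=V\setminus\{\mathsf{root}\}$. A leaf is a vertex $u$ with $\mathsf{Chi}(u)=\varnothing$. Put $\mathsf{Chi}^{\langle1\rangle}(v)=\mathsf{Chi}(v)$ and $\mathsf{Chi}^{\langle n+1\rangle}(v)=\bigcup_{u\in\mathsf{Chi}^{\langle n\rangle}(v)}\mathsf{Chi}(u)$. A rooted tree has finite depth if $\mathsf{Chi}^{\langle N\rangle}(\mathsf{root})=\varnothing$ for some $N\geqslant1$. For weights $\boldsymbol\lambda=\{\lambda_v\}_{v\in V^\circ}\subseteq\mathbb C$ with $\sup_{v\in V}\sum_{u\in\mathsf{Chi}(v)}|\lambda_u|^2<\infty$, the weighted shift $S_{\boldsymbol\lambda}$ on $\mathscr T$ is the bounded operator on $\ell^2(V)$ given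 by $(S_{\boldsymbol\lambda}f)(v)=\lambda_vf(\mathsf{par}(v))$ for $v\in V^\circ$ and $(S_{\boldsymbol\lambda}f)(\mathsf{root})=0$. $\boldsymbol B(\mathcal H)$ denotes the bounded operators on $\mathcal H$; $\mathcal R(A)$ is the range of $A$. A bounded operator $T$ on a complex Hilbert space $\mathcal H$ is centered if all the operators $T^{n}T^{*n}$, $T^{*n}T^{n}$, $n\geqslant1$, commute with each other. Let $T=U|T|$ be the polar decomposition ($U$ a partial isometry with $\ker U=\ker T$). A centered $T$ is type III centered if $U$ is an orthogonal sum of nilpotent operators; equivalently, $\bigcap_{n=1}^\infty\overline{\mathcal R(T^n)}=\{0\}$ and $\bigcap_{n=1}^\infty\overline{\mathcal R(|T^n|)}=\{0\}$. *)

(* Defs.v *)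
From HB Require Import structures.
From mathcomp Require Import all_boot all_order all_algebra.
From mathcomp Require Import sesquilinear complex.
From mathcomp Require Import all_classical all_reals all_analysis.
From mathcomp Require Import ring lra.

Set Implicit Arguments.
Unset Strict Implicit.
Unset Printing Implicit Defensive.
Import Order.TTheory GRing.Theory Num.Theory.

Local Open Scope classical_set_scope.
Local Open Scope ring_scope.

Section DirectedTrees.
Variable V : choiceType.

(* [cycle edge [:: x]] unfolds to [edge x x]: loops count as circuits. *)
Record dtree := Dtree {
  edge : rel V;
  dtree_connected : forall u v : V,
    exists2 p, path (fun x y => edge x y || edge y x) u p & last u p = v;
  dtree_acyclic : forall p : seq V, cycle edge p -> p = [::];
  dtree_parent : forall u1 u2 v : V, edge u1 v -> edge u2 v -> u1 = u2
}.

Record rooted_dtree := RootedDtree {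
  dtree_of :> dtree;
  droot : V;
  root_parentless : forall u : V, ~~ edge dtree_of u droot
}.

Definition Chi (T : dtree) (u : V) : set V := [set v | edge T u v].

(* The junk value [v] is returned when [v] has no parent. *)
Definition par (T : dtree) (v : V) : V := xget v [set u | edge T u v].

Definition is_leaf (T : dtree) (u : V) : Prop := Chi T u = set0.

Fixpoint Chin (T : dtree) (n : nat) (v : V) : set V :=
  if n is m.+1 then \bigcup_(u in Chin T m v) Chi T u else [set v].

Lemma Chin1 (T : dtree) (v : V) : Chin T 1 v = Chi T v.
Proof. by rewrite /= bigcup_set1. Qed.

Definition finite_depth (T : rooted_dtree) : Prop :=
  exists2 N : nat, (1 <= N)%N & Chin T N (droot T) = set0.

Lemma edge_par (T : dtree) (u v : V) : edge T u v -> par T v = u.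
Proof.
move=> uv; rewrite /par; case: xgetP => [w _ /= wv|/(_ u)//].
exact: dtree_parent wv uv.
Qed.

Lemma edge_neq_root (T : rooted_dtree) (u v : V) : edge T u v -> v != droot T.
Proof. by move=> uv; apply: contraTneq uv => ->; exact: root_parentless. Qed.

Lemma par_edge (T : rooted_dtree) (v : V) :
  v != droot T -> edge T (par T v) v.
Proof.
suff [q] : exists2 q, path (edge T) (droot T) q & last (droot T) q = v.
  case/lastP: q => [_ /= ->|q x]; first by rewrite eqxx.
  rewrite rcons_path last_rcons => /andP[_ xe] xv _.
  by move: xe; rewrite xv => xe; rewrite (edge_par xe).
have [p pp <-] := dtree_connected T (droot T) v.
elim/last_ind: p pp {v} => [|p x IH]; first by exists [::].
rewrite rcons_path last_rcons => /andP[/IH[q pq lq] {IH}] /orP[xy|yx].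
  by exists (rcons q x); rewrite ?last_rcons// rcons_path pq lq.
case/lastP: q pq lq => [_ /= rx|q y].
  by rewrite -rx (negbTE (root_parentless _ _)) in yx.
rewrite rcons_path last_rcons => /andP[pq qy] ly.
by exists q => //; apply: dtree_parent qy _; rewrite ly.
Qed.

End DirectedTrees.

Local Notation Re := complex.Re.
Local Notation Im := complex.Im.

Section UnorderedSums.
Variables (R : realType) (V : choiceType).
Implicit Types (a b p q : V -> R) (g h : V -> R[i]).

Definition psum p : \bar R := (\esum_(v in [set: V]) (p v)%:E)%E.

Definition psummable p : Prop := (psum p < +oo)%E.

(* Sum of an absolutely summable real family, the difference of the sums of its
   positive and negative parts. *)
Definition rsum a : R :=
  fine (psum (fun v => Num.max (a v) 0)) -
  fine (psum (fun v => Num.max (- a v) 0)).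

Definition csum h : R[i] :=
  Complex (rsum (fun v => Re (h v))) (rsum (fun v => Im (h v))).

Lemma psum_ge0 p : (forall v, 0 <= p v) -> (0 <= psum p)%E.
Proof. by move=> p0; apply: esum_ge0 => v _; rewrite lee_fin. Qed.

Lemma eq_psum p q : p =1 q -> psum p = psum q.
Proof. by move=> pq; apply: eq_esum => v _; rewrite pq. Qed.

Lemma le_psum p q : (forall v, p v <= q v) -> (psum p <= psum q)%E.
Proof. by move=> pq; apply: le_esum => v _; rewrite lee_fin. Qed.

Lemma psumD p q : (forall v, 0 <= p v) -> (forall v, 0 <= q v) ->
  psum (fun v => p v + q v) = (psum p + psum q)%E.
Proof.
by move=> p0 q0; rewrite /psum -esumD// => v _; rewrite lee_fin.
Qed.

Lemma psumZ c p : 0 <= c -> (forall v, 0 <= p v) ->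
  psum (fun v => c * p v) = (c%:E * psum p)%E.
Proof.
move=> c0 p0; rewrite /psum /esum -ereal_supZl//; last first.
  apply/set0P; exists 0%E, set0; last by rewrite fsbig_set0.
  exact: fsets_set0.
congr ereal_sup; rewrite image_comp/=; apply: eq_imagel => F _ /=.
by rewrite ge0_mule_fsumr// => v; rewrite lee_fin.
Qed.

Lemma psum_fin p : (forall v, 0 <= p v) -> psummable p ->
  psum p \is a fin_num.
Proof. by move=> p0 poo; rewrite ge0_fin_numE// psum_ge0. Qed.

Lemma psum_ltD p q : (forall v, 0 <= p v) -> (forall v, 0 <= q v) ->
  psummable p -> psummable q ->
  psummable (fun v => p v + q v).
Proof. by move=> p0 q0 poo qoo; rewrite /psummable psumD// lte_add_pinfty. Qed.

Lemma psum_ltZ c p : 0 <= c -> (forall v, 0 <= p v) -> psummable p ->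
  psummable (fun v => c * p v).
Proof.
move=> c0 p0 poo; rewrite /psummable psumZ// lte_mul_pinfty//.
Qed.

Lemma rsumE a p q : (forall v, 0 <= p v) -> (forall v, 0 <= q v) ->
  psummable p -> psummable q -> (forall v, a v = p v - q v) ->
  rsum a = fine (psum p) - fine (psum q).
Proof.
move=> p0 q0 poo qoo apq; rewrite /rsum.
set A := fun v => Num.max (a v) 0; set B := fun v => Num.max (- a v) 0.
have A0 v : 0 <= A v by rewrite /A le_max lexx orbT.
have B0 v : 0 <= B v by rewrite /B le_max lexx orbT.
have Aoo : psummable A.
  apply: le_lt_trans poo; apply: le_psum => v.
  by rewrite /A ge_max p0 andbT apq gerBl.
have Boo : psummable B.
  apply: le_lt_trans qoo; apply: le_psum => v.
  by rewrite /B ge_max q0 andbT apq opprB gerBl.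
have : (psum A + psum q = psum B + psum p)%E.
  rewrite -!psumD//; apply: eq_psum => v; rewrite /A /B apq opprB.
  by have [] := leP (p v - q v) 0; have [] := leP (q v - p v) 0; lra.
move/(congr1 fine); rewrite !fineD ?psum_fin//; lra.
Qed.

Lemma rsum_ge0E p : (forall v, 0 <= p v) -> psummable p ->
  rsum p = fine (psum p).
Proof.
move=> p0 poo; have z : psum (fun=> 0 : R) = 0%E by exact: esum1.
by rewrite (@rsumE _ p (fun=> 0)) /psummable ?z ?subr0// => v; rewrite subr0.
Qed.

Lemma posneg a : [/\ forall v, 0 <= Num.max (a v) 0,
  forall v, 0 <= Num.max (- a v) 0 &
  forall v, a v = Num.max (a v) 0 - Num.max (- a v) 0].
Proof.
split=> v; rewrite ?le_max ?lexx ?orbT//.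
by have [] := leP (a v) 0; have [] := leP (- a v) 0; lra.
Qed.

Lemma posneg_fin a : psummable (fun v => `|a v|) ->
  psummable (fun v => Num.max (a v) 0) /\
  psummable (fun v => Num.max (- a v) 0).
Proof.
move=> aoo; split; apply: le_lt_trans aoo; apply: le_psum => v.
  by rewrite ge_max normr_ge0 andbT ler_norm.
by rewrite ge_max normr_ge0 andbT -normrN ler_norm.
Qed.

Lemma rsumD a b : psummable (fun v => `|a v|) ->
  psummable (fun v => `|b v|) ->
  rsum (fun v => a v + b v) = rsum a + rsum b.
Proof.
move=> /posneg_fin[ap an] /posneg_fin[bp bn].
have [p1 n1 e1] := posneg a; have [p2 n2 e2] := posneg b.
rewrite (@rsumE _ (fun v => Num.max (a v) 0 + Num.max (b v) 0)
                  (fun v => Num.max (- a v) 0 + Num.max (- b v) 0)).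
- by rewrite !psumD// !fineD ?psum_fin// /rsum; ring.
- by move=> v; rewrite addr_ge0.
- by move=> v; rewrite addr_ge0.
- exact: psum_ltD.
- exact: psum_ltD.
- by move=> v; rewrite {1}e1 {1}e2; ring.
Qed.

Lemma rsumN a : rsum (fun v => - a v) = - rsum a.
Proof.
rewrite /rsum opprB; congr (fine _ - fine _).
by apply: eq_psum => v; rewrite opprK.
Qed.

Lemma rsumZ c a : psummable (fun v => `|a v|) ->
  rsum (fun v => c * a v) = c * rsum a.
Proof.
wlog c0 : c / 0 <= c => [W aoo|].
  have [/W->//|c0] := leP 0 c.
  rewrite -[c]opprK mulNr -W ?oppr_ge0 1?ltW//.
  rewrite -rsumN; congr rsum; apply/funext => v.
  by rewrite mulNr.
move=> /posneg_fin[ap an]; have [p1 n1 e1] := posneg a.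
rewrite (@rsumE _ (fun v => c * Num.max (a v) 0)
                  (fun v => c * Num.max (- a v) 0)).
- by rewrite !psumZ// !fineM ?psum_fin//= /rsum mulrBr.
- by move=> v; rewrite mulr_ge0.
- by move=> v; rewrite mulr_ge0.
- exact: psum_ltZ.
- exact: psum_ltZ.
- by move=> v; rewrite {1}e1; ring.
Qed.

Definition csummable h :=
  psummable (fun v => `|Re (h v)|) /\
  psummable (fun v => `|Im (h v)|).

Lemma csumD g h : csummable g -> csummable h ->
  csum (fun v => g v + h v) = csum g + csum h.
Proof.
move=> [gR gI] [hR hI]; apply/eqP; rewrite eq_complex /=; apply/andP; split;
  apply/eqP.
  rewrite -rsumD//; congr rsum; apply/funext => v.
  by case: (g v) (h v) => ? ? [].
rewrite -rsumD//; congr rsum; apply/funext => v.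
by case: (g v) (h v) => ? ? [].
Qed.

Lemma csumZ c h : csummable h -> csum (fun v => c * h v) = c * csum h.
Proof.
case: c => x y [hR hI].
have abs_fin z a : psummable (fun v => `|a v|) ->
    psummable (fun v => `|z * a v|).
  move=> aoo; rewrite /psummable (@eq_psum _ (fun v => `|z| * `|a v|)).
    by apply: psum_ltZ.
  by move=> v; rewrite normrM.
apply/eqP; rewrite eq_complex /=; apply/andP; split; apply/eqP.
  rewrite -rsumZ// -rsumZ// -rsumN -rsumD; last 2 first.
  - exact: abs_fin.
  - rewrite /psummable (@eq_psum _ (fun v => `|y * Im (h v)|)); first exact: abs_fin.
    by move=> v; rewrite normrN.
  by congr rsum; apply/funext => v; case: (h v).
rewrite -rsumZ// -rsumZ// -rsumD; last 2 first.
- exact: abs_fin.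
- exact: abs_fin.
by congr rsum; apply/funext => v; case: (h v).
Qed.

Lemma csum_conj h : csum (fun v => (h v)^*) = (csum h)^*.
Proof.
apply/eqP; rewrite eq_complex /=; apply/andP; split; apply/eqP.
  by congr rsum; apply/funext => v; case: (h v).
by rewrite -rsumN; congr rsum; apply/funext => v; case: (h v).
Qed.

End UnorderedSums.

(* The Hilbert space l^2(V) of square-summable complex functions on [V]. *)
Section Ell2.
Variables (R : realType) (V : choiceType).
Implicit Types (f g : V -> R[i]).

Definition sqmod (z : R[i]) : R := Re z ^+ 2 + Im z ^+ 2.

Lemma sqmodE (z : R[i]) : (sqmod z)%:C%C = `|z| ^+ 2.
Proof. exact: add_Re2_Im2. Qed.

Definition ell2_pred : {pred V -> R[i]} :=
  fun f => `[< psummable (fun v => sqmod (f v)) >].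

Lemma sqmod_ge0 z : 0 <= sqmod z.
Proof. by rewrite addr_ge0// sqr_ge0. Qed.

Lemma sqmodM y z : sqmod (y * z) = sqmod y * sqmod z.
Proof. by case: y z => a b [c d]; rewrite /sqmod /=; ring. Qed.

Lemma sqmodD_le y z : sqmod (y + z) <= 2 * sqmod y + 2 * sqmod z.
Proof.
case: y z => a b [c d]; rewrite /sqmod /= -subr_ge0.
have -> : 2 * (a ^+ 2 + b ^+ 2) + 2 * (c ^+ 2 + d ^+ 2) -
   ((a + c) ^+ 2 + (b + d) ^+ 2) = (a - c) ^+ 2 + (b - d) ^+ 2 by ring.
by rewrite addr_ge0// sqr_ge0.
Qed.

Lemma ell2_submod_closed : submod_closed ell2_pred.
Proof.
split=> [|c f g /asboolP foo /asboolP goo]; apply/asboolP.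
  by rewrite /psummable /psum esum1// => v _; rewrite /sqmod /= expr0n/= addr0.
have h0 (h : V -> R[i]) v : 0 <= sqmod (h v) by exact: sqmod_ge0.
apply: (@le_lt_trans _ _ (psum (fun v => 2 * sqmod c * sqmod (f v) +
                                         2 * sqmod (g v)))).
  by apply: le_psum => v; rewrite (le_trans (sqmodD_le _ _))// sqmodM mulrA.
have c0 : 0 <= 2 * sqmod c by rewrite mulr_ge0// sqmod_ge0.
apply: psum_ltD.
- by move=> v; rewrite mulr_ge0.
- by move=> v; rewrite mulr_ge0.
- exact: psum_ltZ.
- exact: psum_ltZ.
Qed.

HB.instance Definition _ :=
  GRing.isSubmodClosed.Build R[i] (V -> R[i]) ell2_pred ell2_submod_closed.

Record ell2 := Ell2 { ell2_fun :> V -> R[i]; _ : ell2_fun \in ell2_pred }.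

HB.instance Definition _ := [isSub for ell2_fun].
HB.instance Definition _ := [Choice of ell2 by <:].
HB.instance Definition _ := [SubChoice_isSubZmodule of ell2 by <:].
HB.instance Definition _ := [SubZmodule_isSubLmodule of ell2 by <:].

Lemma ell2P (f : ell2) : psummable (fun v => sqmod (f v)).
Proof. by case: f => f /= /asboolP. Qed.

Lemma ell2_addE (f g : ell2) v : (f + g) v = f v + g v.
Proof. by []. Qed.

Lemma ell2_scaleE c (f : ell2) v : (c *: f) v = c * f v.
Proof. by []. Qed.

Lemma ell2_ext (f g : ell2) : f =1 g -> f = g.
Proof. by move=> fg; apply/val_inj/funext. Qed.

Definition ell2_dot (f g : ell2) : R[i] := csum (fun v => f v * (g v)^*).

Lemma ell2_dot_summable (f g : ell2) : csummable (fun v => f v * (g v)^*).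
Proof.
have fg : psummable (fun v => sqmod (f v) + sqmod (g v)).
  by apply: psum_ltD; try exact: ell2P; move=> v; exact: sqmod_ge0.
split; apply: le_lt_trans fg; apply: le_psum => v; rewrite /sqmod.
  case: (f v) (g v) => a b [c d] /=; rewrite ler_norml.
  have := (sqr_ge0 a, sqr_ge0 b, sqr_ge0 c, sqr_ge0 d).
  have := (sqr_ge0 (a - c), sqr_ge0 (a + c), sqr_ge0 (b - d), sqr_ge0 (b + d)).
  by move=> [[[? ?] ?] ?] [[[? ?] ?] ?]; apply/andP; split; nra.
case: (f v) (g v) => a b [c d] /=; rewrite ler_norml.
have := (sqr_ge0 a, sqr_ge0 b, sqr_ge0 c, sqr_ge0 d).
have := (sqr_ge0 (a - d), sqr_ge0 (a + d), sqr_ge0 (b - c), sqr_ge0 (b + c)).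
by move=> [[[? ?] ?] ?] [[[? ?] ?] ?]; apply/andP; split; nra.
Qed.

Lemma ell2_dot_herm (f g : ell2) : ell2_dot f g = (ell2_dot g f)^*.
Proof.
rewrite /ell2_dot -csum_conj; congr csum; apply/funext => v.
by rewrite rmorphM /= conjCK mulrC.
Qed.

Lemma ell2_dot_linearl (g : ell2) c (f1 f2 : ell2) :
  ell2_dot (c *: f1 + f2) g = c * ell2_dot f1 g + ell2_dot f2 g.
Proof.
rewrite /ell2_dot -csumZ; last exact: ell2_dot_summable.
have cf1 : csummable (fun v => c * (f1 v * (g v)^*)).
  rewrite (_ : (fun v => _) = (fun v => (c *: f1) v * (g v)^*)).
    exact: ell2_dot_summable.
  by apply/funext => v; rewrite mulrA.
apply: etrans (csumD cf1 (ell2_dot_summable f2 g)).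
by congr csum; apply/funext => v; rewrite ell2_addE ell2_scaleE mulrDl mulrA.
Qed.

Lemma ell2_dot_bilinear :
  bilinear_for (@GRing.mul R[i]) (Num.conj \; *%R) ell2_dot.
Proof.
split=> [g c f1 f2|f c g1 g2] /=; first exact: ell2_dot_linearl.
rewrite ell2_dot_herm ell2_dot_linearl rmorphD rmorphM /=.
by rewrite -!ell2_dot_herm.
Qed.

HB.instance Definition _ := bilinear_isBilinear.Build R[i] ell2 ell2 R[i]
  (@GRing.mul R[i]) (Num.conj \; *%R) ell2_dot ell2_dot_bilinear.

Lemma ell2_dot_hermitian (f g : ell2) :
  ell2_dot f g = (-1) ^+ false * Num.conj (ell2_dot g f).
Proof. by rewrite expr0 mul1r -ell2_dot_herm. Qed.

HB.instance Definition _ :=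
  isHermitianSesquilinear.Build R[i] ell2 false Num.conj ell2_dot
    ell2_dot_hermitian.

Lemma ell2_dotE (f : ell2) :
  ell2_dot f f = (fine (psum (fun v => sqmod (f v))))%:C%C.
Proof.
rewrite -rsum_ge0E; [|by move=> v; exact: sqmod_ge0|exact: ell2P].
apply/eqP; rewrite eq_complex /=; apply/andP; split; apply/eqP.
  by congr rsum; apply/funext => v; rewrite /sqmod; case: (f v) => a b /=; ring.
rewrite (_ : (fun v => _) = fun=> 0).
  have z : psum (fun _ : V => 0 : R) = 0%E by exact: esum1.
  by rewrite rsum_ge0E /psummable ?z.
by apply/funext => v; case: (f v) => a b /=; ring.
Qed.

Lemma ell2_dot_gt0 (f : ell2) : f != 0 -> 0 < ell2_dot f f.
Proof.
move=> f0; have [v fv] : exists v, f v != 0.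
  apply: contrapT => nf; move/eqP: f0; apply; apply: ell2_ext => v.
  by apply/eqP/negPn/negP => fv; apply: nf; exists v.
rewrite ell2_dotE ltcR fine_gt0// ell2P andbT.
apply: (@lt_le_trans _ _ (sqmod (f v))%:E).
  rewrite lte_fin lt_neqAle sqmod_ge0 andbT eq_sym.
  apply: contra fv => /eqP s0.
  by rewrite -normr_eq0 -sqrf_eq0 -sqmodE s0.
apply: esum_ge; exists [set v]; first by split=> //; exact: finite_set1.
by rewrite fsbig_set1.
Qed.

HB.instance Definition _ :=
  isDotProduct.Build R[i] ell2 ell2_dot ell2_dot_gt0.

End Ell2.

Section Operators.
Variables (R : realType) (H : lmodType R[i]) (dot : {dot H for Num.conj}).

(* Bounded operators: ||T x||^2 <= M ||x||^2. *)
Record bop := Bop {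
  bop_fun :> {linear H -> H};
  bop_bounded : exists M : R, forall x : H,
    dot (bop_fun x) (bop_fun x) <= M%:C%C * dot x x
}.

Implicit Types (T Ts U P : bop) (M : set H).

Definition adjoint T Ts : Prop := forall x y : H, dot (T x) y = dot x (Ts y).

(* The adjoint is unique, and it exists for every bounded operator when [H] is
   complete. *)
Definition centered T : Prop :=
  exists2 Ts, adjoint T Ts &
    let powers : set (H -> H) := [set A | exists2 n : nat, (1 <= n)%N &
      A = iter n T \o iter n Ts \/ A = iter n Ts \o iter n T] in
    forall A B : H -> H, powers A -> powers B -> A \o B = B \o A.

Definition positive P : Prop := forall x : H, 0 <= dot (P x) x.

(* P = |T| = (T^* T)^(1/2). *)
Definition is_abs T P : Prop :=
  positive P /\ exists2 Ts, adjoint T Ts & P \o P =1 Ts \o T.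

Definition op_ker T : set H := [set x | T x = 0].

Definition orthocomp M : set H := [set x | forall y, M y -> dot x y = 0].

Definition partial_isometry U : Prop :=
  forall x, orthocomp (op_ker U) x -> dot (U x) (U x) = dot x x.

Definition polar T U P : Prop :=
  [/\ is_abs T P, partial_isometry U, op_ker U = op_ker T & T =1 U \o P].

Definition hclosure M : set H :=
  [set x | forall e : R, 0 < e ->
    exists2 y, M y & dot (x - y) (x - y) < e%:C%C].

Definition closed_subspace M : Prop :=
  [/\ M 0, forall a x y, M x -> M y -> M (a *: x + y) & hclosure M `<=` M].

(* The linear span of a union of subspaces [M i]. *)
Definition span_subspaces (I : Type) (M : I -> set H) : set H :=
  [set x | exists2 s : seq H,
    forall y, y \in s -> exists i, M i y & x = \sum_(y <- s) y].

(* [H] is the Hilbert space orthogonal sum of the [M i]. *)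
Definition orthogonal_decomposition (I : Type) (M : I -> set H) : Prop :=
  [/\ forall i, closed_subspace (M i),
      forall i j x y, i <> j -> M i x -> M j y -> dot x y = 0 &
      forall x, hclosure (span_subspaces M) x].

(* Invariance of every summand makes every summand reducing. *)
Definition orth_sum_of_nilpotents U : Prop :=
  exists (I : Type) (M : I -> set H), orthogonal_decomposition M /\
    forall i, (forall x, M i x -> M i (U x)) /\
      exists n : nat, forall x, M i x -> iter n U x = 0.

Definition typeIII_centered T : Prop :=
  centered T /\ exists U P, polar T U P /\ orth_sum_of_nilpotents U.

End Operators.

Section WeightedShift.
Variables (R : realType) (V : choiceType) (T : rooted_dtree V).
Variable lam : V -> R[i].

(* [lam (droot T)] is never used. *)
Definition bounded_weights : Prop :=
  (ereal_sup [set \esum_(u in Chi T v) (sqmod (lam u))%:E | v in [set: V]]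
    < +oo)%E.

Definition wshift_fun (f : V -> R[i]) : V -> R[i] :=
  fun v => if v == droot T then 0 else lam v * f (par T v).

Hypothesis lam_bounded : bounded_weights.

Lemma wshift_psum : exists2 M : R, 0 <= M & forall f : V -> R[i],
  (psum (fun v => sqmod (wshift_fun f v)) <=
     M%:E * psum (fun v => sqmod (f v)))%E.
Proof.
pose c v := (\esum_(u in Chi T v) (sqmod (lam u))%:E)%E.
pose S := ereal_sup [set c v | v in [set: V]].
have c0 v : (0 <= c v)%E by apply: esum_ge0 => u _; rewrite lee_fin sqmod_ge0.
have cS v : (c v <= S)%E by apply: ereal_sup_ubound; exists v.
have S0 : (0 <= S)%E := le_trans (c0 (droot T)) (cS (droot T)).
have Sfin : S \is a fin_num by rewrite ge0_fin_numE.
exists (fine S); first exact: fine_ge0.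
move=> f; rewrite -psumZ ?fine_ge0//; last by move=> v; exact: sqmod_ge0.
have -> : psum (fun v => sqmod (wshift_fun f v)) =
    (\esum_(v in \bigcup_(u in [set: V]) Chi T u)
       (sqmod (wshift_fun f v))%:E)%E.
  rewrite [RHS]esum_mkcond; apply: eq_esum => v _; case: ifPn => // vC.
  rewrite /wshift_fun; case: eqP => [_|/eqP vr].
    by rewrite /sqmod /= expr0n /= addr0.
  by case/negP: vC; rewrite inE; exists (par T v) => //; exact: par_edge.
have -> : (\esum_(v in \bigcup_(u in [set: V]) Chi T u)
       (sqmod (wshift_fun f v))%:E =
    \esum_(u in [set: V]) \esum_(v in Chi T u) (sqmod (wshift_fun f v))%:E)%E.
  rewrite esum_esum; last by move=> u v _ _; rewrite lee_fin sqmod_ge0.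
  apply: (@reindex_esum _ _ _ _ _ snd); split.
  - by move=> [u v] [/= _ uv]; exists u.
  - move=> [u1 v1] [u2 v2]; rewrite !inE /= => -[_ /= e1] [_ /= e2] e12.
    by subst v2; congr (_, _); exact: dtree_parent e1 e2.
  - by move=> v [u _ uv]; exists (u, v).
apply: le_esum => u _.
rewrite [leLHS](_ : _ = ((sqmod (f u))%:E * c u)%E); last first.
  rewrite (@eq_esum _ _ _ _ (fun v => (sqmod (f u) * sqmod (lam v))%:E)).
    rewrite esum_mkcond /c [X in (_ * X)%E]esum_mkcond.
    rewrite (@eq_esum _ _ _ _ (fun v =>
      (sqmod (f u) * (if v \in Chi T u then sqmod (lam v) else 0))%:E)).
      rewrite -/(psum _) psumZ ?sqmod_ge0//; last first.
        by move=> v; case: ifP => // _; exact: sqmod_ge0.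
      by congr (_ * _)%E; apply: eq_esum => v _; case: ifP.
    by move=> v _; case: ifP => // _; rewrite mulr0.
  move=> v /= uv; rewrite /wshift_fun (negbTE (edge_neq_root uv)).
  by rewrite (edge_par uv) sqmodM mulrC.
rewrite EFinM fineK// muleC lee_wpmul2r// lee_fin; exact: sqmod_ge0.
Qed.

Lemma wshift_subproof (f : ell2 R V) : wshift_fun f \in @ell2_pred R V.
Proof.
have [M M0 le_M] := wshift_psum; apply/asboolP.
apply: le_lt_trans (le_M _) _; rewrite lte_mul_pinfty//; exact: ell2P.
Qed.

Definition wshift_ell2 (f : ell2 R V) : ell2 R V := Ell2 (wshift_subproof f).

Lemma wshift_linear : linear wshift_ell2.
Proof.
move=> a f g; apply: ell2_ext => v.
change (wshift_fun (a *: f + g) v = a * wshift_fun f v + wshift_fun g v).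
rewrite /wshift_fun; case: eqP => _; first by rewrite mulr0 addr0.
by rewrite [X in _ * X](_ : _ = a * f (par T v) + g (par T v))//; ring.
Qed.

HB.instance Definition _ :=
  GRing.isLinear.Build R[i] (ell2 R V) (ell2 R V) *:%R wshift_ell2
    wshift_linear.

Lemma wshift_bounded : exists M : R, forall f : ell2 R V,
  ell2_dot (wshift_ell2 f) (wshift_ell2 f) <= M%:C%C * ell2_dot f f.
Proof.
have [M M0 le_M] := wshift_psum; exists M => f.
have fin (g : ell2 R V) : psum (fun v => sqmod (g v)) \is a fin_num.
  by apply: psum_fin; [move=> v; exact: sqmod_ge0|exact: ell2P].
rewrite !ell2_dotE -rmorphM lecR -lee_fin EFinM (fineK (fin f)).
by rewrite (fineK (fin (wshift_ell2 f))); exact: le_M.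
Qed.

Definition wshift : bop (@ell2_dot R V) :=
  Bop (bop_fun := wshift_ell2) wshift_bounded.

End WeightedShift.

(* Main.v *)
Require Import Defs.
From HB Require Import structures.
From mathcomp Require Import all_boot all_order all_algebra.
From mathcomp Require Import sesquilinear complex.
From mathcomp Require Import all_classical all_reals all_analysis.

Set Implicit Arguments.
Unset Strict Implicit.
Unset Printing Implicit Defensive.
Import Order.TTheory GRing.Theory Num.Theory.

Local Open Scope classical_set_scope.
Local Open Scope ring_scope.

(** Write $e_v$ for the unit vector at $v$. The operator $S^*S$ is diagonal and
    multiplies $e_u$ by $\|S e_u\|^2$, the sum of $|\lambda_v|^2$ over the
    children $v$ of $u$, called the mass of $u$ below. Given that $S$ is
    centered, $S^*S$ commutes with $S^n S^{*n}$. For a vertex $v$ of depth $n$,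
    $S^{*n} e_v$ is a nonzero multiple of $e_{root}$, and $S^n e_{root}$ is
    nonzero at every vertex $w$ of depth $n$; so the $(w, v)$ entry of
    $S^n S^{*n}$ is nonzero, and commutation with a diagonal operator forces
    equal diagonal entries at $v$ and $w$ ([centered_mass]). The mass is thus
    constant on each generation. It vanishes at a leaf, hence on the whole
    generation of that leaf, and as the weights are nonzero no vertex of that
    generation has a child: the tree has finite depth
    ([centered_leaf_finite_depth]).

    For the type, the partial isometry $U$ of the polar decomposition of $S$ is
    itself a weighted shift on the same tree ([polar_wshift]). On a tree of
    finite depth every weighted shift is nilpotent ([iter_wshift_eq0]), so $U$
    is an orthogonal sum of nilpotent operators with a single summand. *)

(** * Generations of a rooted tree *)

Section Generations.
Variables (V : choiceType) (T : rooted_dtree V).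

Lemma exists_generation (v : V) : exists n, Chin T n (droot T) v.
Proof.
have [p pp <-] := dtree_connected T (droot T) v.
elim/last_ind: p pp {v} => [|p x IH] /=; first by exists 0%N.
rewrite rcons_path last_rcons => /andP[/IH[n nl] /orP[lx|xl]].
  by exists n.+1; exists (last (droot T) p).
case: n nl => [/= lr|n [u nu ul]].
  by rewrite lr (negbTE (root_parentless _ _)) in xl.
by exists n; rewrite (dtree_parent xl ul).
Qed.

Lemma Chin_set0 (n m : nat) :
  (n <= m)%N -> Chin T n (droot T) = set0 -> Chin T m (droot T) = set0.
Proof.
by move=> /subnK <- n0; elim: (m - n)%N => //= k ->; rewrite bigcup_set0.
Qed.

End Generations.

(** * Sums over the vertices and unit vectors *)

Section UnitVectors.
Variables (R : realType) (V : choiceType).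

Lemma psum_point (p : V -> R) (u : V) :
  0 <= p u -> (forall v, v != u -> p v = 0) -> psum p = (p u)%:E.
Proof.
move=> pu p0; rewrite /psum -(@esum_set1 _ _ u (fun v => (p v)%:E)) ?lee_fin//.
rewrite [RHS]esum_mkcond; apply: eq_esum => v _; case: ifPn => // vu.
by rewrite p0//; apply: contraNneq vu => ->; rewrite inE.
Qed.

Lemma esumZ (D : set V) (c : R) (p : V -> R) :
  0 <= c -> (forall v, 0 <= p v) ->
  (\esum_(v in D) (c * p v)%:E = c%:E * \esum_(v in D) (p v)%:E)%E.
Proof.
move=> c0 p0; rewrite esum_mkcond [X in (_ * X)%E]esum_mkcond.
pose q v := if v \in D then p v else 0.
have q0 v : 0 <= q v by rewrite /q; case: ifP.
transitivity (psum (fun v => c * q v)).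
  by apply: eq_esum => v _; rewrite /q; case: ifP; rewrite ?mulr0.
by rewrite psumZ//; congr (_ * _)%E; apply: eq_esum => v _; rewrite /q; case: ifP.
Qed.

Lemma rsum_point (a : V -> R) (u : V) :
  (forall v, v != u -> a v = 0) -> rsum a = a u.
Proof.
move=> a0; have [p0 n0 apn] := posneg a; rewrite /rsum.
rewrite (@psum_point _ u (p0 u)) => [|v /a0 ->]; last by rewrite maxxx.
rewrite (@psum_point _ u (n0 u)) => [|v /a0 ->]; last by rewrite oppr0 maxxx.
by rewrite /= [RHS]apn.
Qed.

Lemma csum_point (h : V -> R[i]) (u : V) :
  (forall v, v != u -> h v = 0) -> csum h = h u.
Proof.
move=> h0; rewrite /csum !(@rsum_point _ u) => [|v /h0 ->//|v /h0 ->//].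
by case: (h u).
Qed.

Lemma csum_ge0 (h : V -> R[i]) : (forall v, 0 <= h v) -> 0 <= csum h.
Proof.
move=> h0; have reh v : 0 <= complex.Re (h v) /\ complex.Im (h v) = 0.
  by have := h0 v; rewrite lecE /= => /andP[/eqP ->].
rewrite lecE /=; apply/andP; split.
  have z : psum (fun _ : V => 0 : R) = 0%E by exact: esum1.
  rewrite (_ : (fun v => _) = fun=> 0); first by rewrite rsum_ge0E /psummable ?z.
  by apply/funext => v; have [] := reh v.
rewrite /rsum subr_ge0 (@eq_psum _ _ _ (fun=> 0)).
  rewrite {1}/psum esum1//= fine_ge0// psum_ge0// => v.
  by rewrite le_max lexx orbT.
by move=> v; apply/max_idPr; rewrite oppr_le0; have [] := reh v.
Qed.

Lemma sqmod_real (r : R) : sqmod r%:C%C = r ^+ 2.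
Proof. by rewrite /sqmod /= expr0n/= addr0. Qed.

Lemma sqmod_eq0 (z : R[i]) : (sqmod z == 0) = (z == 0).
Proof.
by rewrite -(inj_eq (@complexI R)) sqmodE rmorph0 sqrf_eq0 normr_eq0.
Qed.

Lemma sqmod0 : sqmod 0 = 0 :> R. Proof. by apply/eqP; rewrite sqmod_eq0. Qed.

Definition delta_fun (u : V) : V -> R[i] := fun v => (v == u)%:R.

Lemma delta_subproof u : delta_fun u \in @ell2_pred R V.
Proof.
apply/asboolP; rewrite /psummable (@psum_point _ u) ?ltry ?sqmod_ge0//.
by move=> v /negbTE vu; rewrite /delta_fun vu sqmod0.
Qed.

Definition delta (u : V) : ell2 R V := Ell2 (delta_subproof u).

Lemma deltaE u v : delta u v = (v == u)%:R. Proof. by []. Qed.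

Lemma ell2_dot_delta (f : ell2 R V) u : ell2_dot f (delta u) = f u.
Proof.
rewrite /ell2_dot (@csum_point _ u) ?deltaE ?eqxx ?rmorph1 ?mulr1//.
by move=> v /negbTE vu; rewrite deltaE vu rmorph0 mulr0.
Qed.

End UnitVectors.

(** * Diagonal operators *)

Section DiagonalOperators.
Variables (R : realType) (V : choiceType) (d : V -> R) (B : R).
Hypothesis d_bounded : forall v, d v ^+ 2 <= B.

Definition diag_fun (f : V -> R[i]) : V -> R[i] := fun v => (d v)%:C%C * f v.

Let sqmod_diag (f : V -> R[i]) v : sqmod (diag_fun f v) <= B * sqmod (f v).
Proof.
rewrite sqmodM ler_wpM2r ?sqmod_ge0// (le_trans _ (d_bounded v))//.
by rewrite sqmod_real.
Qed.

Lemma diag_psum (f : ell2 R V) :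
  (psum (fun v => sqmod (diag_fun f v))
     <= (Num.max B 0%R)%:E * psum (fun v => sqmod (f v)))%E.
Proof.
rewrite -psumZ; [|by rewrite le_max lexx orbT|by move=> v; exact: sqmod_ge0].
apply: le_psum => v; apply: le_trans (sqmod_diag _ _) _.
by rewrite ler_wpM2r ?sqmod_ge0// le_max lexx.
Qed.

Lemma diag_subproof (f : ell2 R V) : diag_fun f \in @ell2_pred R V.
Proof.
apply/asboolP; apply: le_lt_trans (diag_psum _) _.
by rewrite lte_mul_pinfty ?lee_fin ?le_max ?lexx ?orbT//; exact: ell2P.
Qed.

Definition diag_ell2 (f : ell2 R V) : ell2 R V := Ell2 (diag_subproof f).

Lemma diag_linear : linear diag_ell2.
Proof.
move=> a f g; apply: ell2_ext => v.
rewrite -[LHS]/(diag_fun (a *: f + g) v) -[RHS]/(a * diag_fun f v + diag_fun g v).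
by rewrite /diag_fun ell2_addE ell2_scaleE mulrDr mulrCA.
Qed.

HB.instance Definition _ :=
  GRing.isLinear.Build R[i] (ell2 R V) (ell2 R V) *:%R diag_ell2 diag_linear.

Lemma diag_bounded : exists M : R, forall f : ell2 R V,
  ell2_dot (diag_ell2 f) (diag_ell2 f) <= M%:C%C * ell2_dot f f.
Proof.
exists (Num.max B 0) => f.
have fin (g : ell2 R V) : psum (fun v => sqmod (g v)) \is a fin_num.
  by apply: psum_fin; [move=> v; exact: sqmod_ge0|exact: ell2P].
rewrite !ell2_dotE -rmorphM lecR -lee_fin EFinM (fineK (fin f)).
by rewrite (fineK (fin (diag_ell2 f))); exact: diag_psum.
Qed.

Definition diag_op : bop (@ell2_dot R V) := Bop (bop_fun := diag_ell2) diag_bounded.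

Lemma diag_opE f v : diag_op f v = (d v)%:C%C * f v. Proof. by []. Qed.

Lemma diag_positive : (forall v, 0 <= d v) -> positive diag_op.
Proof.
move=> d0 f; apply: csum_ge0 => v; rewrite diag_opE -mulrA mulr_ge0 ?ler0c//.
exact: mul_conjC_ge0.
Qed.

End DiagonalOperators.

(** * Weighted shifts and their masses *)

Section WeightedShifts.
Variables (R : realType) (V : choiceType) (T : rooted_dtree V) (lam : V -> R[i]).

Definition Chi_mass (u : V) : \bar R :=
  (\esum_(v in Chi T u) (sqmod (lam v))%:E)%E.

Lemma Chi_mass_ge0 u : (0 <= Chi_mass u)%E.
Proof. by apply: esum_ge0 => v _; rewrite lee_fin sqmod_ge0. Qed.

Lemma le_Chi_mass u v : edge T u v -> ((sqmod (lam v))%:E <= Chi_mass u)%E.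
Proof.
move=> uv; apply: esum_ge; exists [set v]; last by rewrite fsbig_set1.
by split; [exact: finite_set1|move=> _ ->].
Qed.

(** Pythagoras for $S f$, the sum of the $f(u) S e_u$: the vectors $S e_u$ have disjoint
    supports, since every vertex has at most one parent. *)
Lemma psum_wshift (f : V -> R[i]) :
  psum (fun v => sqmod (wshift_fun T lam f v)) =
  (\esum_(u in [set: V]) ((sqmod (f u))%:E * Chi_mass u))%E.
Proof.
transitivity (\esum_(v in \bigcup_(u in [set: V]) Chi T u)
                (sqmod (wshift_fun T lam f v))%:E)%E.
  rewrite [RHS]esum_mkcond; apply: eq_esum => v _; case: ifPn => // vC.
  rewrite /wshift_fun; case: eqP => [_|/eqP vr]; first by rewrite sqmod0.
  by case/negP: vC; rewrite inE; exists (par T v) => //; exact: par_edge.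
transitivity (\esum_(u in [set: V]) \esum_(v in Chi T u)
                (sqmod (wshift_fun T lam f v))%:E)%E.
  rewrite esum_esum; last by move=> u v _ _; rewrite lee_fin sqmod_ge0.
  apply: (@reindex_esum _ _ _ _ _ snd); split.
  - by move=> [u v] [/= _ uv]; exists u.
  - move=> [u1 v1] [u2 v2]; rewrite !inE /= => -[_ /= e1] [_ /= e2] e12.
    by subst v2; congr (_, _); exact: dtree_parent e1 e2.
  - by move=> v [u _ uv]; exists (u, v).
apply: eq_esum => u _; rewrite /Chi_mass -esumZ ?sqmod_ge0//; last first.
  by move=> v; exact: sqmod_ge0.
apply: eq_esum => v uv; rewrite /wshift_fun (negbTE (edge_neq_root uv)).
by rewrite (edge_par uv) sqmodM mulrC.
Qed.

Hypothesis lam_bounded : bounded_weights T lam.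
Local Notation S := (wshift lam_bounded).

Lemma wshiftE (f : ell2 R V) u v : edge T u v -> S f v = lam v * f u.
Proof.
move=> uv; rewrite [LHS]/(wshift_fun T lam f v) /wshift_fun.
by rewrite (negbTE (edge_neq_root uv)) (edge_par uv).
Qed.

Lemma wshift_root (f : ell2 R V) : S f (droot T) = 0.
Proof. by rewrite [LHS]/(wshift_fun T lam f _) /wshift_fun eqxx. Qed.

Lemma wshift_kerP (f : ell2 R V) :
  op_ker S f <-> forall u v, edge T u v -> lam v * f u = 0.
Proof.
split=> [f0 u v uv|f0]; first by rewrite -(wshiftE f uv) (f0 : S f = 0).
apply: ell2_ext => v; have [->|vr] := eqVneq v (droot T); first exact: wshift_root.
by rewrite (wshiftE _ (par_edge vr)) f0// par_edge.
Qed.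

Lemma Chi_mass_bounded :
  exists B : R, forall u, (Chi_mass u <= B%:E)%E.
Proof.
move: lam_bounded; rewrite /bounded_weights; set s := ereal_sup _ => soo.
have le_s u : (Chi_mass u <= s)%E by apply: ereal_sup_ubound; exists u.
have s0 : (0 <= s)%E := le_trans (Chi_mass_ge0 (droot T)) (le_s _).
by exists (fine s) => u; rewrite fineK// ge0_fin_numE.
Qed.

Definition mass (u : V) : R := fine (Chi_mass u).

Lemma massK u : (mass u)%:E = Chi_mass u.
Proof.
have [B leB] := Chi_mass_bounded; rewrite fineK// ge0_fin_numE ?Chi_mass_ge0//.
exact: le_lt_trans (leB u) (ltry _).
Qed.

Lemma mass_ge0 u : 0 <= mass u. Proof. exact/fine_ge0/Chi_mass_ge0. Qed.

Lemma le_mass u v : edge T u v -> sqmod (lam v) <= mass u.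
Proof. by move=> /le_Chi_mass; rewrite -massK lee_fin. Qed.

Lemma weight_eq0 u v : edge T u v -> mass u = 0 -> lam v = 0.
Proof.
move=> /le_mass + u0; rewrite u0 => le0; apply/eqP.
by rewrite -sqmod_eq0 eq_le le0 sqmod_ge0.
Qed.

Lemma ell2_dot_wshift (f : ell2 R V) :
  ell2_dot (S f) (S f) = (fine (psum (fun u => sqmod (f u) * mass u)))%:C%C.
Proof.
rewrite ell2_dotE [X in fine X]psum_wshift; congr (fine _)%:C%C.
by apply: eq_esum => u _; rewrite EFinM massK.
Qed.

(** The coordinate at $u$ of $S^*S f$ is the inner product of $S f$ and $S e_u$,
    and on the support of $S e_u$, the children of $u$, the vector $S f$ agrees
    with $f(u) S e_u$. *)
Lemma adjoint_wshiftK Ss f u : adjoint S Ss -> Ss (S f) u = (mass u)%:C%C * f u.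
Proof.
move=> adj; rewrite -ell2_dot_delta ell2_dot_herm -adj -ell2_dot_herm.
transitivity (f u * ell2_dot (S (delta R u)) (S (delta R u))).
  rewrite /ell2_dot -csumZ; last exact: ell2_dot_summable.
  congr csum; apply/funext => v.
  have [->|vr] := eqVneq v (droot T); first by rewrite !wshift_root !(mul0r, mulr0).
  rewrite !(wshiftE _ (par_edge vr)) deltaE.
  case: eqP => [->|_]; last by rewrite !(mulr0, mul0r, rmorph0).
  by rewrite mulr1 mulrA (mulrC (f u)).
rewrite ell2_dot_wshift (@psum_point _ _ _ u) ?deltaE.
- by rewrite eqxx /= /sqmod /= expr1n expr0n /= addr0 mul1r mulrC.
- by rewrite mulr_ge0 ?sqmod_ge0 ?mass_ge0.
- by move=> v /negbTE vu; rewrite deltaE vu sqmod0 mul0r.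
Qed.

Lemma adjoint_wshift_delta Ss u v :
  adjoint S Ss -> edge T u v -> Ss (delta R v) = (lam v)^* *: delta R u.
Proof.
move=> adj uv; apply: ell2_ext => w; rewrite ell2_scaleE.
transitivity ((ell2_dot (S (delta R w)) (delta R v))^*).
  by rewrite -ell2_dot_delta ell2_dot_herm -adj.
rewrite ell2_dot_delta (wshiftE _ uv) !deltaE eq_sym.
by rewrite rmorphM /= conjC_nat.
Qed.

Lemma iterZ (H : lmodType R[i]) (A : {linear H -> H}) n a x :
  iter n A (a *: x) = a *: iter n A x.
Proof. by elim: n => //= n ->; rewrite linearZ. Qed.

(** Each application of $S$ moves the values of $f$ one generation away from the
    root, so that $S^k f$ vanishes at all vertices of depth less than $k$. *)
Lemma iter_wshift_eq0 n f :
  Chin T n (droot T) = set0 -> iter n S f = 0.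
Proof.
have vanish k m v : (m < k)%N -> Chin T m (droot T) v -> iter k S f v = 0.
  elim: k m v => // k IH [|m] v; first by move=> _ ->; rewrite iterS wshift_root.
  by move=> mk [u um uv]; rewrite iterS (wshiftE _ uv) (IH m u)// mulr0.
move=> n0; apply: ell2_ext => v; have [m vm] := exists_generation T v.
by apply: (vanish n m) => //; rewrite ltnNge; apply/negP => /Chin_set0/(_ n0) mE;
  rewrite mE in vm.
Qed.

Section NonzeroWeights.
Hypothesis lam_neq0 : forall v, v != droot T -> lam v != 0.

Lemma iter_wshift_root n v : Chin T n (droot T) v ->
  iter n S (delta R (droot T)) v != 0.
Proof.
elim: n v => [v ->|n IH v [u un uv]].
  by rewrite [iter _ _ _]/= deltaE eqxx oner_eq0.
by rewrite iterS (wshiftE _ uv) mulf_neq0 ?IH// lam_neq0// (edge_neq_root uv).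
Qed.

(** The backward shift carries $e_v$ along the path from $v$ up to the root,
    collecting the conjugate weights. *)
Lemma iter_adjoint_wshift Ss n v : adjoint S Ss -> Chin T n (droot T) v ->
  exists2 a, a != 0 & iter n Ss (delta R v) = a *: delta R (droot T).
Proof.
move=> adj; elim: n v => [v ->|n IH v [u /IH[a a0 nE] uv]].
  by exists 1; rewrite ?oner_eq0 ?scale1r.
exists ((lam v)^* * a).
  by rewrite mulf_neq0// conjC_eq0 lam_neq0// (edge_neq_root uv).
by rewrite iterSr (adjoint_wshift_delta adj uv) iterZ nE scalerA.
Qed.

(** Compare the $(w, v)$ entries of $S^n S^{*n} S^* S$ and $S^* S S^n S^{*n}$:
    the first is the mass of $v$, the second the mass of $w$, times the entry of
    $S^n S^{*n}$, which is nonzero. *)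
Lemma centered_mass n v w : centered S ->
  Chin T n (droot T) v -> Chin T n (droot T) w -> mass v = mass w.
Proof.
move=> [Ss adj comm].
(* Depth 0 is the root alone. *)
case: n => [->->//|n] vn wn.
have Apow : exists2 k, (1 <= k)%N &
    iter n.+1 S \o iter n.+1 Ss = iter k S \o iter k Ss \/
    iter n.+1 S \o iter n.+1 Ss = iter k Ss \o iter k S.
  by exists n.+1; [|left].
have Bpow : exists2 k, (1 <= k)%N &
    Ss \o S = iter k S \o iter k Ss \/ Ss \o S = iter k Ss \o iter k S.
  by exists 1%N; [|right].
have := congr1 (fun A : ell2 R V -> ell2 R V => A (delta R v) w) (comm _ _ Apow Bpow).
have massE : Ss (S (delta R v)) = (mass v)%:C%C *: delta R v.
  apply: ell2_ext => x; rewrite (adjoint_wshiftK _ _ adj) ell2_scaleE deltaE.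
  by case: eqP => [->|]; rewrite ?mulr0.
rewrite -[LHS]/(iter n.+1 S (iter n.+1 Ss (Ss (S (delta R v)))) w).
rewrite -[RHS]/(Ss (S (iter n.+1 S (iter n.+1 Ss (delta R v)))) w).
rewrite (adjoint_wshiftK _ _ adj) massE 2!iterZ ell2_scaleE.
have [a a0 ->] := iter_adjoint_wshift adj vn.
rewrite iterZ ell2_scaleE => /mulIf/complexI; apply.
by rewrite mulf_neq0// iter_wshift_root.
Qed.

Lemma centered_leaf_finite_depth n v : centered S ->
  Chin T n (droot T) v -> is_leaf T v -> Chin T n.+1 (droot T) = set0.
Proof.
move=> cS vn leafv; rewrite -subset0 => w [u un uw] /=.
have v0 : mass v = 0 by rewrite /mass /Chi_mass leafv esum_set0.
have := lam_neq0 (edge_neq_root uw).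
by rewrite (weight_eq0 uw) ?eqxx// -(centered_mass cS vn un).
Qed.

End NonzeroWeights.

End WeightedShifts.

(** * The polar decomposition of a weighted shift *)

Section PolarDecomposition.
Variables (R : realType) (V : choiceType) (T : rooted_dtree V) (lam : V -> R[i]).
Hypothesis lam_bounded : bounded_weights T lam.
Local Notation S := (wshift lam_bounded).
Local Notation m := (mass T lam).

Lemma sqrt_mass_eq0 u : (Num.sqrt (m u) == 0) = (m u == 0).
Proof. by rewrite sqrtr_eq0 eq_le mass_ge0 andbT. Qed.

(** The partial isometry in the polar decomposition of the shift is again a
    weighted shift: since $|S|$ multiplies $e_u$ by $\|S e_u\|$, the weights of
    the children of $u$ have to be divided by $\|S e_u\|$. When $S e_u = 0$,
    these weights vanish already, which agrees with the convention $0^{-1} = 0$. *)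
Definition polar_weight (v : V) : R[i] :=
  (Num.sqrt (m (par T v)))^-1%:C%C * lam v.

Lemma polar_weight_eq0 u v : edge T u v -> (polar_weight v == 0) = (lam v == 0).
Proof.
move=> uv; rewrite /polar_weight (edge_par uv) mulf_eq0.
rewrite (inj_eq (@complexI R)) invr_eq0 sqrt_mass_eq0.
have [u0|//] := eqVneq (m u) 0.
by rewrite (weight_eq0 lam_bounded uv u0) eqxx.
Qed.

Lemma Chi_mass_polar u : Chi_mass T polar_weight u = (m u != 0)%:R%:E.
Proof.
transitivity ((m u)^-1%:E * Chi_mass T lam u)%E.
  rewrite /Chi_mass -esumZ ?invr_ge0 ?mass_ge0//; last by move=> v; exact: sqmod_ge0.
  apply: eq_esum => v uv; rewrite /polar_weight (edge_par uv) sqmodM sqmod_real.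
  by rewrite exprVn sqr_sqrtr ?mass_ge0.
rewrite -(massK lam_bounded) -EFinM.
by have [->|u0] := eqVneq (m u) 0; rewrite ?mulr0// mulVf.
Qed.

Lemma polar_bounded : bounded_weights T polar_weight.
Proof.
apply: (@le_lt_trans _ _ 1%E); last exact: ltry.
apply: ge_ereal_sup => _ [u _ <-]; rewrite -/(Chi_mass _ _ _) Chi_mass_polar.
by case: eqP; rewrite lee_fin.
Qed.

Local Notation U := (wshift polar_bounded).

Lemma polar_ker : op_ker U = op_ker S.
Proof.
have weightE u v (z : R[i]) : edge T u v ->
    (polar_weight v * z == 0) = (lam v * z == 0).
  by move=> uv; rewrite mulf_eq0 (polar_weight_eq0 uv) -mulf_eq0.
apply/seteqP; split=> f /wshift_kerP f0; apply/wshift_kerP => u v uv; apply/eqP.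
  by rewrite -(weightE _ _ _ uv) (f0 _ _ uv).
by rewrite (weightE _ _ _ uv) (f0 _ _ uv).
Qed.

(** The children of $u$ carry total polar mass 1 unless $S e_u = 0$, so the norm
    of $U f$ is that of $f$ restricted to the $u$ with $S e_u \neq 0$. At the
    other vertices $f$ vanishes, because $e_u$ lies in the kernel of $U$. *)
Lemma polar_partial_isometry : partial_isometry U.
Proof.
move=> f f_perp; rewrite -[LHS]/(ell2_dot (U f) (U f)) -[RHS]/(ell2_dot f f).
rewrite !ell2_dotE [X in fine X]psum_wshift; congr (fine _)%:C%C.
apply: eq_esum => u _; rewrite Chi_mass_polar.
have [u0|_] := eqVneq (m u) 0; last by rewrite mule1.
suff -> : f u = 0 by rewrite sqmod0 mul0e.
rewrite -ell2_dot_delta; apply: f_perp; apply/wshift_kerP => u' v uv.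
rewrite deltaE; case: eqP => [uu|_]; last by rewrite mulr0.
apply/eqP; rewrite mulf_eq0 (polar_weight_eq0 uv).
by rewrite (weight_eq0 lam_bounded uv) ?eqxx// uu.
Qed.

(** $|S|$ is the diagonal operator with entries $\|S e_u\|$, whose square is
    $S^*S$. *)
Lemma polar_wshift Ss : adjoint S Ss -> exists P, polar S U P.
Proof.
move=> adj; have [B leB] := Chi_mass_bounded lam_bounded.
have sB u : Num.sqrt (m u) ^+ 2 <= B.
  by rewrite sqr_sqrtr ?mass_ge0// -lee_fin (massK lam_bounded).
exists (diag_op sB); split; [|exact: polar_partial_isometry|exact: polar_ker|].
- split; first by apply: diag_positive => u; exact: sqrtr_ge0.
  exists Ss => // f; apply: ell2_ext => u.
  rewrite (adjoint_wshiftK _ _ adj) [LHS]diag_opE diag_opE mulrA -rmorphM /= -expr2.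
  by rewrite sqr_sqrtr ?mass_ge0.
move=> f; apply: ell2_ext => v.
have [->|vr] := eqVneq v (droot T); first by rewrite !wshift_root.
have uv := par_edge vr; rewrite !(wshiftE _ _ uv) diag_opE.
have [u0|u0] := eqVneq (m (par T v)) 0.
  by rewrite /polar_weight (weight_eq0 lam_bounded uv u0) mulr0 !mul0r.
rewrite /polar_weight mulrA; congr (_ * _).
rewrite mulrAC -rmorphM /= mulVf ?mul1r//.
by rewrite sqrt_mass_eq0.
Qed.

End PolarDecomposition.

(** * Type III *)

(** The whole space serves as the only summand. *)
Lemma nilpotent_orth_sum (R : realType) (H : lmodType R[i])
    (dot : {dot H for Num.conj}) (U : bop dot) n :
  (forall x, iter n U x = 0) -> orth_sum_of_nilpotents U.
Proof.
move=> Un0; exists unit, (fun=> setT); split; last by split=> //; exists n.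
split=> [//|[] [] //|x e e0]; exists x; last by rewrite subrr linear0l ltcR.
exists [:: x]; last by rewrite big_seq1.
by move=> y _; exists tt.
Qed.

Theorem proposition25 (R : realType) (V : choiceType) (T : rooted_dtree V)
    (lam : V -> R[i]) (lam_bounded : bounded_weights T lam)
    (lam_neq0 : forall v : V, v != droot T -> lam v != 0)
    (S_centered : centered (wshift lam_bounded))
    (T_leaf : exists v : V, is_leaf T v) :
  finite_depth T /\ typeIII_centered (wshift lam_bounded).
Proof.
have [v leafv] := T_leaf; have [n vn] := exists_generation T v.
have T_depth := centered_leaf_finite_depth lam_neq0 S_centered vn leafv.
split; first by exists n.+1.
split=> //; have [Ss adj _] := S_centered; have [P SUP] := polar_wshift adj.
exists (wshift (polar_bounded lam_bounded)), P; split=> //.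
by apply: (@nilpotent_orth_sum _ _ _ _ n.+1) => f; exact: iter_wshift_eq0.
Qed.
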